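(* For any $\alpha,\epsilon>0$ there exists $N_0$ such that the following holds. Let $G$ be a finite abelian group of order $N\ge N_0$ and let $M_1,M_2$ be automorphisms of $G$ such that $M_1-M_2$ is an automorphism. Then for any $A\subseteq G$ with $|A|\ge\alpha N$ there is $d\in G$, $d\neq 0$, such that \[\#\{x\in G:\ x,\ x+M_1d,\ x+M_2d\in A\}\ \ge\ (\alpha^3-\epsilon)N.\]
   Context: $(M_1-M_2)(x)=M_1(x)-M_2(x)$. *)

(* Defs.v *)
From HB Require Import structures.
From mathcomp Require Import all_boot all_order all_algebra.
From mathcomp Require Import reals.

Set Implicit Arguments.
Unset Strict Implicit.
Unset Printing Implicit Defensive.

Import Order.TTheory GRing.Theory Num.Theory.

Local Open Scope ring_scope.

Definition is_automorphism (G : zmodType) (M : G -> G) : Prop :=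
  zmod_morphism M /\ bijective M.

(* Main.v *)
Require Import Defs.
From HB Require Import structures.
From mathcomp Require Import all_boot all_order all_algebra.
From mathcomp Require Import reals.
From mathcomp Require Import ring lra zify.

Set Implicit Arguments.
Unset Strict Implicit.
Unset Printing Implicit Defensive.

Import Order.TTheory GRing.Theory Num.Theory.

Local Open Scope ring_scope.

(** Let f be the indicator of A and, for T in G, let F_T be the average of
    f(x + t - t') over t, t' in T.  Random sampling and the pigeonhole principle
    give, for a dense T, a dense T' such that F_T is almost invariant under d,
    M1 d and M2 d, and the autocorrelation of f under d, for all d in T' - T'.
    Then the energy of F grows from T to T' by about the squared L2 distance of
    F_T and F_T', so along a chain of such refinements there are consecutive
    T, T', T'' with F_T'' close to F_T in L2.  Write
    f = F_T + (F_T'' - F_T) + (f - F_T'') and average the count of the pattern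
    over d in T' - T'.  The last term has a tiny autocorrelation, hence (as M1,
    M2 and M1 - M2 are bijective) contributes little by Cauchy-Schwarz even
    relative to the density of T'; the middle term is small in L1; and F_T is
    almost invariant, so the average is close to the mean of F_T^3, which is at
    least alpha^3.  The shift d = 0 has weight 1/|T'|. *)

(** * Averages over finite sets *)

(* By [x / 0 = 0], the mean over the empty set is 0. *)
Definition mean (R : realFieldType) (I : finType) (T : {set I}) (f : I -> R) : R :=
  (\sum_(i in T) f i) / #|T|%:R.

Local Notation "\avg_ ( x 'in' T ) F" := (mean T (fun x => F))
  (at level 36, F at level 36, x at level 50, format "\avg_ ( x  'in'  T )  F").
Local Notation "\avg_ x F" := (mean setT (fun x => F))
  (at level 36, F at level 36, x at level 0, format "\avg_ x  F").

Section Mean.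
Variables (R : realFieldType) (I : finType).
Implicit Types (T : {set I}) (f g : I -> R) (c : R).

Lemma eq_mean T f g : {in T, f =1 g} -> mean T f = mean T g.
Proof. by move=> fg; rewrite /mean (eq_bigr _ fg). Qed.

Lemma meanD T f g : \avg_(i in T) (f i + g i) = mean T f + mean T g.
Proof. by rewrite /mean big_split mulrDl. Qed.

Lemma meanN T f : \avg_(i in T) (- f i) = - mean T f.
Proof. by rewrite /mean sumrN mulNr. Qed.

Lemma meanB T f g : \avg_(i in T) (f i - g i) = mean T f - mean T g.
Proof. by rewrite meanD meanN. Qed.

Lemma meanZ T c f : \avg_(i in T) (c * f i) = c * mean T f.
Proof. by rewrite /mean -mulr_sumr mulrA. Qed.

Lemma meanZr T c f : \avg_(i in T) (f i * c) = mean T f * c.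
Proof. by rewrite mulrC -meanZ; apply: eq_mean => i _; rewrite mulrC. Qed.

Lemma mean_cst T c : (0 < #|T|)%N -> \avg_(i in T) c = c.
Proof.
move=> T0; rewrite /mean sumr_const -[c *+ _]mulr_natr mulfK //.
by rewrite pnatr_eq0 -lt0n.
Qed.

Lemma le_mean T f g : {in T, forall i, f i <= g i} -> mean T f <= mean T g.
Proof. by move=> fg; rewrite ler_wpM2r ?invr_ge0 // ler_sum. Qed.

Lemma mean_ge0 T f : {in T, forall i, 0 <= f i} -> 0 <= mean T f.
Proof. by move=> f0; rewrite mulr_ge0 ?invr_ge0 // sumr_ge0. Qed.

Lemma mean_le_cst T f c :
  0 <= c -> {in T, forall i, f i <= c} -> mean T f <= c.
Proof.
move=> c0 fc; case: (posnP #|T|) => [T0|T0]; last first.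
  by rewrite -[leRHS](mean_cst c T0); exact: le_mean.
by rewrite /mean T0 invr0 mulr0.
Qed.

Lemma ler_norm_mean T f : `|mean T f| <= \avg_(i in T) `|f i|.
Proof.
by rewrite normrM normfV normr_nat ler_wpM2r ?invr_ge0 // ler_norm_sum.
Qed.

(* The variance is nonnegative. *)
Lemma mean_sqr_le T f : mean T f ^+ 2 <= \avg_(i in T) (f i ^+ 2).
Proof.
case: (posnP #|T|) => [T0|T0].
  by rewrite /mean T0 invr0 !mulr0 expr0n.
have : 0 <= \avg_(i in T) ((f i - mean T f) ^+ 2).
  by apply: mean_ge0 => i _; exact: sqr_ge0.
rewrite (eq_mean (g := fun i => f i ^+ 2 - (mean T f *+ 2 * f i - mean T f ^+ 2)));
  last by move=> i _ /=; ring.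
rewrite meanB meanB meanZ mean_cst // => h.
by rewrite -subr_ge0; apply: le_trans h _; rewrite le_eqVlt; apply/orP; left; apply/eqP; ring.
Qed.

Lemma mean_abs_le T f c :
  0 <= c -> \avg_(i in T) (f i ^+ 2) <= c ^+ 2 -> \avg_(i in T) `|f i| <= c.
Proof.
move=> c0 h; rewrite -ler_sqr ?nnegrE ?mean_ge0 //.
apply: le_trans (mean_sqr_le _ _) _.
by under eq_mean => i _ do rewrite real_normK ?num_real //.
Qed.

(** Extending the sum from [T] to all of [I] adds nonnegative terms; the factor corrects the
    normalisation. *)
Lemma mean_le_density T f :
  (forall i, 0 <= f i) ->
  mean T f <= #|I|%:R / #|T|%:R * mean setT f.
Proof.
move=> f0; case: (posnP #|T|) => [T0|T0].
  by rewrite /mean T0 invr0 !mulr0 mul0r.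
have I0 : (0 < #|I|)%N := leq_trans T0 (max_card _).
rewrite /mean cardsT [leRHS]mulrC mulrA divfK ?pnatr_eq0 -?lt0n //.
rewrite ler_wpM2r ?invr_ge0 //.
rewrite big_mkcond [leRHS]big_mkcond; apply: ler_sum => i _.
by rewrite inE; case: ifP.
Qed.

Lemma mean_bij (h : I -> I) f : bijective h -> \avg_i (f (h i)) = mean setT f.
Proof.
move=> bh; rewrite /mean [in RHS](reindex h); first last.
  exact: onW_bij.
by congr (_ / _); apply: eq_bigl => i; rewrite !inE.
Qed.

End Mean.

Lemma mean_exchange (R : realFieldType) (I J : finType) (S : {set I})
    (T : {set J}) (f : I -> J -> R) :
  \avg_(i in S) (\avg_(j in T) (f i j)) = \avg_(j in T) (\avg_(i in S) (f i j)).
Proof.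
rewrite /mean -!mulr_suml exchange_big /= -!mulrA; congr (_ * _).
by rewrite mulrC.
Qed.

Lemma mean_shift (R : realFieldType) (G : finZmodType) (a : G) (f : G -> R) :
  \avg_x (f (x + a)) = mean setT f.
Proof. by apply: (mean_bij f); exists (fun x => x - a) => x; rewrite ?addrK ?subrK. Qed.

(** * Sampling and pigeonhole *)

Lemma exists_le_mean (R : realFieldType) (I : finType) (f : I -> R) :
  (0 < #|I|)%N -> exists i, f i <= mean setT f.
Proof.
move=> I0; apply/existsP; apply: contraT; rewrite negb_exists => /forallP h.
have [i0 _] : exists i0 : I, i0 \in I by apply/card_gt0P.
have : \avg_i (f i - mean setT f) = 0 by rewrite meanB mean_cst ?subrr // cardsT.
have fm i : 0 < f i - mean setT f by rewrite subr_gt0 ltNge.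
move/eqP; rewrite {1}/mean mulf_eq0 invr_eq0 cardsT pnatr_eq0 (gtn_eqF I0) orbF.
rewrite psumr_eq0 => [/allP/(_ i0 (mem_index_enum _))|i _]; last exact: ltW.
by rewrite inE gt_eqF.
Qed.

(* Greedy form of Maurey's empirical method: picking the sample one point at a
   time, the cross term vanishes on average over the next point. *)
Lemma greedy_sampling (R : realFieldType) (I Y : finType) (X : Y -> I -> R) (k : nat) :
  (0 < #|Y|)%N -> (forall i, \avg_y (X y i) = 0) -> (forall y i, `|X y i| <= 1) ->
  exists ys : k.-tuple Y, \sum_i (\sum_(y <- ys) X y i) ^+ 2 <= (k * #|I|)%:R.
Proof.
move=> Y0 X0 X1; elim: k => [|k [ys ysP]].
  exists [tuple]; rewrite mul0n big1 // => i _.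
  by rewrite big_nil expr0n.
pose s i := \sum_(y <- ys) X y i.
have [y yP] := exists_le_mean (fun y => \sum_i (X y i + s i) ^+ 2) Y0.
exists [tuple of y :: ys].
under eq_bigr => i _ do rewrite big_cons -/(s i).
apply: le_trans yP _.
have cI : \sum_(i : I) 1 = #|I|%:R :> R.
  by rewrite -sum1_card natr_sum; apply: eq_bigl.
rewrite /mean exchange_big mulr_suml mulSn natrD -cI.
apply: le_trans (_ : \sum_i (1 + s i ^+ 2) <= _); last first.
  by rewrite big_split /= lerD2l.
apply: ler_sum => i _; rewrite -/(mean _ _).
rewrite (eq_mean (g := fun y => X y i ^+ 2 + (s i *+ 2 * X y i + s i ^+ 2)));
  last by move=> y' _ /=; ring.
rewrite meanD meanD meanZ X0 mulr0 add0r mean_cst ?cardsT // lerD2r.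
apply: mean_le_cst => // y' _.
by rewrite -real_normK ?num_real // expr_le1.
Qed.

(** A most frequent value works, since the fibres partition [P]; [sig i0] seeds the arg max. *)
Lemma pigeonhole_fiber (I V : finType) (sig : I -> V) (P : {set I}) (i0 : I) :
  exists v, (#|P| <= #|V| * #|[set i in P | sig i == v]|)%N.
Proof.
pose c v := #|[set i in P | sig i == v]|.
have cP : #|P| = (\sum_v c v)%N.
  rewrite -sum1_card (partition_big sig xpredT) //=.
  by apply: eq_bigr => v _; rewrite /c -sum1_card; apply: eq_bigl => i; rewrite inE.
exists [arg max_(v > sig i0) c v]; case: arg_maxnP => // v _ vP.
rewrite cP -sum_nat_const; apply: leq_sum => w _; exact: vP.
Qed.

(** * Almost periods by random sampling *)

Section AlmostPeriods.
Variables (R : realFieldType) (G : finZmodType).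
Implicit Types (f g : G -> R) (S T : {set G}) (a : G).

Definition shift_dist g a : R := \avg_x ((g (x + a) - g x) ^+ 2).

(** Two functions in one: for [f] the indicator of [S] it is the autocorrelation of [f]; in general
    it is the average of [f] over [x + S], times the density of [S]. *)
Definition corr S f (x : G) : R := \avg_y ((y \in S)%:R * f (x + y)).

Lemma card_zmod_gt0 : (0 < #|G|)%N.
Proof. by apply/card_gt0P; exists 0. Qed.

Lemma avg_cst c : \avg_(x in [set: G]) c = c :> R.
Proof. by rewrite mean_cst // cardsT card_zmod_gt0. Qed.

(** Markov's inequality at twice the bound on the mean. *)
Lemma half_le_avg (W : G -> R) (c : R) :
  0 < c -> (forall s, 0 <= W s) -> mean setT W <= c ->
  (#|G| <= 2 * #|[set s | (W s <= c *+ 2)%R]|)%N.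
Proof.
move=> c0 W0 Wc.
have n0 : 0 < #|G|%:R :> R by rewrite ltr0n card_zmod_gt0.
pose B := [set s | W s <= c *+ 2].
have h : \sum_(s in ~: B) c *+ 2 <= c * #|G|%:R.
  apply: le_trans (_ : \sum_s W s <= _).
    rewrite big_mkcond; apply: ler_sum => s _; case: ifP => //.
    by rewrite !inE -ltNge => /ltW.
  move: Wc; rewrite /mean cardsT ler_pdivrMr //; apply: le_trans.
  by rewrite le_eqVlt (eq_bigl (mem setT)) ?eqxx // => i; rewrite !inE.
move: h; rewrite sumr_const -mulrnA mulr_natr ler_pMn2l // => h.
by move: h; rewrite -/B -(cardsC B); lia.
Qed.

(* Croot-Sisask: two shifts producing the same membership pattern on a sample
   that is good for both yield nearly equal translates of [corr (S j) f]. *)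
Lemma almost_periods (n k : nat) (S : 'I_n -> {set G}) (L : 'I_n -> G -> G) f :
    (0 < n)%N -> (0 < k)%N -> (forall j, zmod_morphism (L j)) ->
    (forall x, 0 <= f x <= 1) ->
  exists T : {set G}, (#|G| <= 2 * 2 ^ (n * k) * #|T|)%N /\
    forall j t t', t \in T -> t' \in T ->
      k%:R * shift_dist (corr (S j) f) (L j (t - t')) <= (8 * n)%:R.
Proof.
move=> n0 k0 Ladd f01.
(* An index [(s, (j, x))] holds a shift, a set number and a point. The shift [s] enters the sampled
   term only through the membership test; substituting [y + L j s] for [y] shows that [X] has mean
   zero. *)
pose X (y : G) (i : G * ('I_n * G)) : R :=
  (y - L i.2.1 i.1 \in S i.2.1)%:R * f (i.2.2 + y)
  - corr (S i.2.1) f (i.2.2 + L i.2.1 i.1).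
have b01 (S0 : {set G}) y x : 0 <= (y \in S0)%:R * f x <= 1.
  by have := f01 x; case: (y \in S0) => /=; rewrite ?mul1r ?mul0r // lexx ler01.
have c01 S0 x : 0 <= corr S0 f x <= 1.
  apply/andP; split; first by apply: mean_ge0 => y _; case/andP: (b01 S0 y (x + y)).
  by apply: mean_le_cst => // y _; case/andP: (b01 S0 y (x + y)).
have X0 i : \avg_y (X y i) = 0.
  rewrite meanB avg_cst /corr; apply/eqP; rewrite subr_eq0; apply/eqP.
  rewrite -[RHS](mean_shift (- L i.2.1 i.1)).
  by apply: eq_mean => y _; rewrite addrACA addrN addr0 /=.
have X1 y i : `|X y i| <= 1.
  rewrite /X; set u := _ * _; set v := corr _ _ _.
  have /andP[] : 0 <= u <= 1 by exact: b01.
  have /andP[] : 0 <= v <= 1 by exact: c01.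
  by move=> *; rewrite ler_norml; apply/andP; split; lra.
have [ys ysP] := greedy_sampling k card_zmod_gt0 X0 X1.
pose Z i := (\sum_(y <- ys) X y i) ^+ 2.
pose W s := \sum_(p : 'I_n * G) Z (s, p).
have NR : 0 < #|G|%:R :> R by rewrite ltr0n card_zmod_gt0.
have Wavg : mean setT W <= (k * (n * #|G|))%:R.
  rewrite /mean cardsT ler_pdivrMr //.
  have -> : \sum_(s in [set: G]) W s = \sum_i Z i.
    rewrite (eq_bigl xpredT) => [|s]; last by rewrite inE.
    by rewrite pair_bigA; apply: eq_bigr => -[].
  by move: ysP; rewrite !card_prod card_ord (mulnC #|G|) mulnA natrM.
have c0 : 0 < (k * (n * #|G|))%:R :> R.
  by rewrite ltr0n !muln_gt0 k0 n0 card_zmod_gt0.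
have W0 s : 0 <= W s by apply: sumr_ge0 => p _; exact: sqr_ge0.
have := half_le_avg c0 W0 Wavg; set good := [set s | _] => goodP.
(* The pattern of [s] has [n * k] bits, which accounts for the loss [2 ^ (n * k)]. *)
pose sig s := [ffun p : 'I_n * 'I_k => tnth ys p.2 - L p.1 s \in S p.1].
have [v vP] := pigeonhole_fiber sig good 0.
exists [set s in good | sig s == v]; split.
  move: vP; rewrite card_ffun card_bool card_prod !card_ord => vP.
  by apply: leq_trans goodP _; rewrite -mulnA leq_mul2l.
move=> j t t'; rewrite !inE => /andP[Wt /eqP st] /andP[Wt' /eqP st'].
set h := corr (S j) f.
(* Equal patterns give equal empirical sums, so only the two sampling errors remain. *)
have key x : k%:R * (h (x + L j t) - h (x + L j t')) =
    \sum_(y <- ys) X y (t', (j, x)) - \sum_(y <- ys) X y (t, (j, x)).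
  rewrite /X !sumrB /= -/h !big_tuple !sumr_const card_ord.
  rewrite (eq_bigr (fun i => (tnth ys i - L j t \in S j)%:R * f (x + tnth ys i))).
    by rewrite -[h (x + L j t) *+ _]mulr_natl -[h (x + L j t') *+ _]mulr_natl; ring.
  move=> i _; congr ((nat_of_bool _)%:R * _).
  by have /ffunP/(_ (j, i)) := etrans st (esym st'); rewrite !ffunE.
have ZW s : s \in good -> \sum_x Z (s, (j, x)) <= (k * (n * #|G|))%:R *+ 2.
  rewrite inE; apply: le_trans; rewrite /W -(pair_bigA _ (fun j x => Z (s, (j, x)))) /=.
  rewrite (bigD1 j) //= lerDl sumr_ge0 // => i _; apply: sumr_ge0 => x _.
  exact: sqr_ge0.
rewrite /shift_dist -(mean_shift (L j t')).
rewrite (eq_mean (g := fun x => (h (x + L j t) - h (x + L j t')) ^+ 2)); last first.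
  by move=> x _ /=; rewrite Ladd -addrA (addrC (L j t')) subrK.
have k0R : 0 < k%:R :> R by rewrite ltr0n.
rewrite -(ler_pM2l k0R) mulrA -expr2 -meanZ /mean cardsT ler_pdivrMr //.
(* The constant 8 arises here: [(u - w)^2 <= 2 u^2 + 2 w^2], and both error sums are at most twice
   the average bound. *)
apply: le_trans (_ : \sum_x (Z (t, (j, x)) *+ 2 + Z (t', (j, x)) *+ 2) <= _).
  rewrite (eq_bigl xpredT) => [|x]; last by rewrite inE.
  apply: ler_sum => x _; rewrite -exprMn key /Z.
  set u := \sum_(y <- ys) _; set w := \sum_(y <- ys) _.
  by have := sqr_ge0 (u + w); rewrite -subr_ge0 => ?; rewrite -subr_ge0; nra.
rewrite big_split /= !sumrMnl.
have := ZW t; have := ZW t'; rewrite !inE => /(_ Wt') h1 /(_ Wt) h2.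
have -> : k%:R * (8 * n)%:R * #|G|%:R = (k * (n * #|G|))%:R *+ 8 :> R.
  by rewrite !natrM; ring.
by lra.
Qed.
End AlmostPeriods.

(** * Smoothing over differences: energy and autocorrelation *)

Lemma mean_setX (R : realFieldType) (I J : finType) (S : {set I}) (T : {set J})
    (F : I * J -> R) :
  mean (setX S T) F = \avg_(i in S) (\avg_(j in T) F (i, j)).
Proof.
rewrite /mean cardsX natrM invfM mulrA -mulr_suml (mulrAC _ #|S|%:R^-1); congr (_ / _ / _).
rewrite pair_big /=; apply: eq_big => [[i j]|[i j] _] //=.
by rewrite in_setX.
Qed.

Lemma mean_indicator (R : realFieldType) (I : finType) (T : {set I}) (g : I -> R) :
  #|I|%:R / #|T|%:R * \avg_y ((y \in T)%:R * g y) = mean T g.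
Proof.
case: (posnP #|T|) => [T0|T0]; first by rewrite /mean T0 invr0 !mulr0 mul0r.
have I0 : (0 < #|I|)%N := leq_trans T0 (max_card _).
rewrite /mean cardsT mulrC mulrA divfK ?pnatr_eq0 -?lt0n //; congr (_ / _).
rewrite big_mkcond [RHS]big_mkcond; apply: eq_bigr => i _.
by rewrite inE; case: (i \in T); rewrite ?mul1r ?mul0r.
Qed.

Section Smoothing.
Variables (R : realFieldType) (G : finZmodType).
Implicit Types (f g u : G -> R) (T : {set G}).

(** Using differences makes this averaging over translates by [T] followed by its adjoint, hence a
    positive operator. *)
Definition smooth T f x : R := \avg_(p in setX T T) f (x + (p.1 - p.2)).

Definition autocorr u z : R := \avg_y (u y * u (z + y)).

Definition periodic T (L : G -> G) g (delta : R) :=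
  forall t t', t \in T -> t' \in T -> shift_dist g (L (t - t')) <= delta ^+ 2.

Lemma card_setX_gt0 T : (0 < #|T|)%N -> (0 < #|setX T T|)%N.
Proof. by rewrite cardsX muln_gt0 andbb. Qed.

Lemma smooth_ge0_le1 T f :
  (forall x, 0 <= f x <= 1) -> forall x, 0 <= smooth T f x <= 1.
Proof.
move=> f01 x; apply/andP; split.
  by apply: mean_ge0 => p _; case/andP: (f01 (x + (p.1 - p.2))).
by apply: mean_le_cst => // p _; case/andP: (f01 (x + (p.1 - p.2))).
Qed.

Lemma avg_smooth T f : (0 < #|T|)%N -> mean setT (smooth T f) = mean setT f.
Proof.
move=> T0; rewrite /smooth mean_exchange (eq_mean (g := fun=> mean setT f)).
  by rewrite mean_cst // card_setX_gt0.
by move=> p _; exact: mean_shift.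
Qed.

(** Carries almost periods from [corr T f] over to [smooth T f]. *)
Lemma smooth_corr T f x :
  smooth T f x = \avg_(t' in T) (#|G|%:R / #|T|%:R * corr T f (x - t')).
Proof.
rewrite /smooth mean_setX mean_exchange; apply: eq_mean => t' _ /=.
rewrite /corr mean_indicator; apply: eq_mean => t _.
by rewrite -addrA (addrC (- t')).
Qed.

(** By convexity, averaging translates does not increase the distance; the squared inverse density
    comes from rescaling [corr T f]. *)
Lemma shift_dist_smooth T f a :
  shift_dist (smooth T f) a <=
  (#|G|%:R / #|T|%:R) ^+ 2 * shift_dist (corr T f) a.
Proof.
rewrite /shift_dist; set r := _ / _.
apply: le_trans (_ : \avg_x (\avg_(t' in T)
    ((r * (corr T f (x + a - t') - corr T f (x - t'))) ^+ 2)) <= _).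
  apply: le_mean => x _; rewrite !smooth_corr -meanB.
  by under eq_mean => t' _ do rewrite -mulrBr; exact: mean_sqr_le.
rewrite mean_exchange; apply: mean_le_cst => [|t' _].
  by rewrite mulr_ge0 ?sqr_ge0 // mean_ge0 // => x _; exact: sqr_ge0.
rewrite -(mean_shift t') -meanZ; apply: le_mean => x _.
by rewrite exprMn addrAC !addrK.
Qed.

Lemma shift_abs g a (delta : R) : 0 <= delta -> shift_dist g a <= delta ^+ 2 ->
  \avg_x `|g (x + a) - g x| <= delta.
Proof. exact: mean_abs_le. Qed.

(** With [H] the average of [f] over [x + T], the right side is the energy of [H], while
    [smooth T f] is an average of translates of [H]. *)
Lemma smooth_energy T f : (0 < #|T|)%N ->
  \avg_x (smooth T f x ^+ 2) <= \avg_x (f x * smooth T f x).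
Proof.
move=> T0.
pose H x := \avg_(t in T) f (x + t).
have sH x : smooth T f x = \avg_(t in T) H (x - t).
  rewrite /smooth mean_setX mean_exchange; apply: eq_mean => t' _.
  by apply: eq_mean => t _ /=; rewrite addrA addrAC.
have -> : \avg_x (f x * smooth T f x) = \avg_x (H x ^+ 2).
  under eq_mean => x _ do rewrite sH -meanZ.
  rewrite mean_exchange.
  under eq_mean => t _.
    rewrite -(mean_shift t) /=.
    under eq_mean => x _ do rewrite addrK mulrC.
    over.
  rewrite mean_exchange; apply: eq_mean => x _ /=.
  by rewrite meanZ expr2.
apply: le_trans (_ : \avg_x (\avg_(t in T) (H (x - t) ^+ 2)) <= _).
  by apply: le_mean => x _; rewrite sH; exact: mean_sqr_le.
rewrite mean_exchange; apply: mean_le_cst => [|t _].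
  by apply: mean_ge0 => x _; exact: sqr_ge0.
by rewrite (mean_shift (- t) (fun x => H x ^+ 2)).
Qed.

(* Since [smooth T f] is almost invariant under [T' - T'], its inner product with
   [smooth T' f] is nearly its inner product with [f], which is at least its energy. *)
Lemma energy_increment T T' f (delta : R) :
    (forall x, 0 <= f x <= 1) -> 0 <= delta -> (0 < #|T|)%N -> (0 < #|T'|)%N ->
    periodic T' id (smooth T f) delta ->
  \avg_x ((smooth T' f x - smooth T f x) ^+ 2) <=
  \avg_x (smooth T' f x ^+ 2) - \avg_x (smooth T f x ^+ 2) + delta *+ 2.
Proof.
move=> f01 d0 T0 T'0 per; set F := smooth T f; set F' := smooth T' f.
suff cross : \avg_x (F x ^+ 2) - delta <= \avg_x (F x * F' x).
  rewrite (eq_mean (g := fun x => F' x ^+ 2 + (F x ^+ 2 - 2 * (F x * F' x))));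
    last by move=> x _ /=; ring.
  by rewrite meanD meanB meanZ; lra.
apply: le_trans (lerB (smooth_energy f T0) (lexx delta)) _.
rewrite -/F /F'.
under [leRHS]eq_mean => x _ do rewrite -meanZ.
rewrite mean_exchange.
rewrite -[leLHS](mean_cst _ (card_setX_gt0 T'0)).
apply: le_mean => -[t t'] /setXP[/= tT t'T].
(* The substitution moves the shift from [f] to [F], where almost periodicity absorbs it. *)
rewrite -(mean_shift (t' - t) (fun x => F x * _)).
rewrite lerBlDr -lerBlDl -meanB.
apply: le_trans (shift_abs d0 (per _ _ t'T tT)).
apply: le_mean => x _; rewrite -addrA (addrC (t' - t)) subrKA subrr addr0.
apply: le_trans (ler_norm _) _; rewrite mulrC -mulrBl normrM distrC.
case/andP: (f01 x) => fx0 fx1.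
by rewrite ler_piMr // ger0_norm.
Qed.

(** The correlation [D] of [f] with [u] is [autocorr f] minus an average of its shifts by [T - T],
    hence small; [autocorr u] is [D] minus an average of translates of [D]. *)
Lemma autocorr_smooth T f (delta : R) : (0 < #|T|)%N ->
    periodic T id (autocorr f) delta ->
  \avg_z (autocorr (fun x => f x - smooth T f x) z ^+ 2) <= 4 * delta ^+ 2.
Proof.
move=> T0 per; pose u x := f x - smooth T f x.
have TT0 := card_setX_gt0 T0.
pose D z := \avg_y (f y * u (z + y)).
have DE z : D z = \avg_(p in setX T T) (autocorr f z - autocorr f (z + (p.1 - p.2))).
  rewrite /autocorr meanB mean_cst // mean_exchange -meanB.
  apply: eq_mean => y _; rewrite meanZ -mulrBr; congr (_ * (_ - _)).
  by apply: eq_mean => p _; rewrite addrAC.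
have D2 : \avg_z (D z ^+ 2) <= delta ^+ 2.
  apply: le_trans (_ : \avg_z (\avg_(p in setX T T)
     ((autocorr f z - autocorr f (z + (p.1 - p.2))) ^+ 2)) <= _).
    by apply: le_mean => z _; rewrite DE; exact: mean_sqr_le.
  rewrite mean_exchange; apply: mean_le_cst => [|[t t'] /setXP[/= tT t'T]].
    exact: sqr_ge0.
  apply: le_trans (per _ _ tT t'T); apply: le_mean => z _.
  by rewrite -sqrrN opprB.
have uE z : autocorr u z = D z - \avg_(p in setX T T) D (z - (p.1 - p.2)).
  rewrite /autocorr.
  under eq_mean => y _ do rewrite -/(u _) {1}/u mulrBl.
  rewrite meanB -/(D z); congr (_ - _).
  under eq_mean => y _ do rewrite /smooth -meanZr.
  rewrite mean_exchange; apply: eq_mean => p _.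
  rewrite /D -[RHS](mean_shift (p.1 - p.2)); apply: eq_mean => y _.
  by congr (_ * u _); rewrite (addrC y) addrA subrK.
apply: le_trans (_ : \avg_z (2 * D z ^+ 2 +
    2 * \avg_(p in setX T T) (D (z - (p.1 - p.2)) ^+ 2)) <= _).
  apply: le_mean => z _; rewrite -/u uE.
  have := mean_sqr_le (setX T T) (fun p => D (z - (p.1 - p.2))).
  set v := mean _ _; have := sqr_ge0 (D z + v); nra.
rewrite meanD !meanZ mean_exchange.
have : \avg_(p in setX T T) (\avg_z (D (z - (p.1 - p.2)) ^+ 2)) <= delta ^+ 2.
  apply: mean_le_cst => [|p _]; first exact: sqr_ge0.
  by rewrite (mean_shift _ (fun z => D z ^+ 2)).
lra.
Qed.
End Smoothing.

(** * The trilinear pattern average and its Cauchy-Schwarz bounds *)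

Section Trilinear.
Variables (R : realFieldType) (G : finZmodType).
Implicit Types (f g u a b c : G -> R) (T : {set G}) (M P Q : G -> G).

(** The shift is a difference of two independent members of [T], which provides two variables for
    Cauchy-Schwarz. *)
Definition trilin T M1 M2 a b c : R :=
  \avg_(p in setX T T) (\avg_x (a x * b (x + M1 (p.1 - p.2)) * c (x + M2 (p.1 - p.2)))).

Lemma sqr_mean (I : finType) (S : {set I}) (f : I -> R) :
  mean S f ^+ 2 = \avg_(i in S) (\avg_(j in S) (f i * f j)).
Proof. by rewrite expr2 -meanZr; apply: eq_mean => i _; rewrite meanZ. Qed.

Lemma sqr_le_of_norm_le1 (x y : R) : `|x| <= 1 -> (x * y) ^+ 2 <= y ^+ 2.
Proof.
by move=> x1; rewrite exprMn ler_piMl ?sqr_ge0 // -real_normK ?num_real // expr_le1.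
Qed.

(* Two applications of Cauchy-Schwarz. *)
Lemma bilinear_le_autocorr T P Q p q u (x : G) (e : R) :
    zmod_morphism P -> bijective P -> bijective Q ->
    (forall t, `|p t| <= 1) -> (forall t, `|q t| <= 1) -> 0 <= e ->
    (#|G|%:R / #|T|%:R) ^+ 4 * \avg_z (autocorr u z ^+ 2) <= e ^+ 4 ->
  `|\avg_(t in T) (\avg_(t' in T) (p t' * q t * u (x + Q t + P t')))| <= e.
Proof.
move=> Padd bP bQ p1 q1 e0; set r := _ / _ => Se.
have r0 : 0 <= r by rewrite divr_ge0.
set X := mean _ _.
pose V t := \avg_(t' in T) (p t' * u (x + Q t + P t')).
pose Y := \avg_(t' in T) (\avg_(t'' in T) (p t' * p t'' * autocorr u (P (t'' - t')))).
(* Cauchy-Schwarz over [t] removes [q]; extending [t] to all of [G] costs one factor [r]. *)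
have XY : X ^+ 2 <= r * Y.
  have -> : X = \avg_(t in T) (q t * V t).
    by apply: eq_mean => t _; rewrite -meanZ; apply: eq_mean => t' _; ring.
  apply: le_trans (mean_sqr_le _ _) _.
  apply: le_trans (_ : \avg_(t in T) (V t ^+ 2) <= _).
    by apply: le_mean => t _; exact: sqr_le_of_norm_le1.
  apply: le_trans (mean_le_density _ _) _; first by move=> t; exact: sqr_ge0.
  rewrite ler_wpM2l // le_eqVlt; apply/orP; left; apply/eqP.
  under eq_mean => t _ do rewrite sqr_mean.
  rewrite mean_exchange; apply: eq_mean => t' _.
  rewrite mean_exchange; apply: eq_mean => t'' _.
  under eq_mean => t _ do rewrite mulrACA.
  rewrite meanZ; congr (_ * _).
  rewrite (mean_bij (fun t => u (x + t + P t') * u (x + t + P t''))) //.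
  rewrite -(mean_shift (- (x + P t'))); apply: eq_mean => y _.
  have -> : x + (y - (x + P t')) = y - P t' by rewrite opprD addrCA addNKr.
  by rewrite Padd subrK -addrA (addrC y) (addrC (- P t')).
(* Cauchy-Schwarz over [t'] and [t''] removes [p]; extending both ranges costs [r ^+ 2]. *)
have Y2 : Y ^+ 2 <= r ^+ 2 * \avg_z (autocorr u z ^+ 2).
  apply: le_trans (_ : \avg_(t' in T) (\avg_(t'' in T)
      (autocorr u (P (t'' - t')) ^+ 2)) <= _).
    apply: le_trans (mean_sqr_le _ _) _; apply: le_mean => t' _.
    apply: le_trans (mean_sqr_le _ _) _; apply: le_mean => t'' _.
    by apply: sqr_le_of_norm_le1; rewrite normrM mulr_ile1.
  apply: le_trans (_ : \avg_(t' in T) (r * \avg_z (autocorr u z ^+ 2)) <= _).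
    apply: le_mean => t' _.
    apply: le_trans (mean_le_density _ _) _; first by move=> t; exact: sqr_ge0.
    rewrite (mean_shift _ (fun t => autocorr u (P t) ^+ 2)).
    by rewrite (mean_bij (fun t => autocorr u t ^+ 2)).
  apply: le_trans (mean_le_density _ _) _.
    by move=> t; rewrite mulr_ge0 // mean_ge0 // => z _; exact: sqr_ge0.
  by rewrite -/r avg_cst mulrA -expr2.
rewrite -(ler_pXn2r (n := 4)) ?nnegrE //.
apply: le_trans Se; rewrite -normrX ger0_norm ?exprn_even_ge0 //.
rewrite (exprM _ 2 2) (exprM r 2 2).
apply: le_trans (_ : (r * Y) ^+ 2 <= _).
  rewrite ler_sqr ?nnegrE ?sqr_ge0 //; exact: le_trans (sqr_ge0 _) XY.
by rewrite exprMn [(r ^+ 2) ^+ 2]expr2 -mulrA ler_wpM2l ?sqr_ge0.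
Qed.

Lemma zmod_morphism_sub M1 M2 :
  zmod_morphism M1 -> zmod_morphism M2 -> zmod_morphism (M1 \- M2).
Proof. by move=> M1add M2add x y /=; rewrite M1add M2add !opprD addrACA. Qed.

Lemma bij_opp M N : bijective M -> (forall x, N x = - M x) -> bijective N.
Proof.
move=> bM NM; have bo : bijective (-%R : G -> G) by exists -%R; exact: opprK.
by apply: eq_bij (bij_comp bo bM) _ _ => x; rewrite /= NM.
Qed.

Lemma trilin_uniform3 T M1 M2 a b u (e : R) :
    zmod_morphism M1 -> zmod_morphism M2 ->
    bijective M2 -> bijective (M1 \- M2) ->
    (forall t, `|a t| <= 1) -> (forall t, `|b t| <= 1) -> 0 <= e ->
    (#|G|%:R / #|T|%:R) ^+ 4 * \avg_z (autocorr u z ^+ 2) <= e ^+ 4 ->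
  `|trilin T M1 M2 a b u| <= e.
Proof.
move=> M1add M2add bM2 bM12 a1 b1 e0 Se; rewrite /trilin.
(* After [x := x + M1 t'] the first factor no longer depends on [t], nor the
   second on [t']. *)
under eq_mean => p _ do rewrite -(mean_shift (M1 p.2)).
rewrite mean_exchange; apply: le_trans (ler_norm_mean _ _) _.
apply: mean_le_cst => // x _; rewrite mean_setX /=.
rewrite (eq_mean (g := fun t => \avg_(t' in T) (a (x + M1 t') * b (x + M1 t) *
    u (x + M2 t + (M1 \- M2) t')))) => [|t _].
  apply: (bilinear_le_autocorr (p := fun t' => a (x + M1 t'))
    (q := fun t => b (x + M1 t))) => //.
  exact: zmod_morphism_sub.
apply: eq_mean => t' _ /=.
by rewrite M1add M2add (addrC (M1 t)) addrA addrK addrACA.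
Qed.

Lemma trilin_uniform2 T M1 M2 a u c (e : R) :
    zmod_morphism M1 -> zmod_morphism M2 ->
    bijective M1 -> bijective (M1 \- M2) ->
    (forall t, `|a t| <= 1) -> (forall t, `|c t| <= 1) -> 0 <= e ->
    (#|G|%:R / #|T|%:R) ^+ 4 * \avg_z (autocorr u z ^+ 2) <= e ^+ 4 ->
  `|trilin T M1 M2 a u c| <= e.
Proof.
move=> M1add M2add bM1 bM12 a1 c1 e0 Se.
have -> : trilin T M1 M2 a u c = trilin T M2 M1 a c u.
  by apply: eq_mean => p _; apply: eq_mean => x _; rewrite mulrAC.
apply: trilin_uniform3 => //.
by apply: bij_opp bM12 _ => x /=; rewrite opprB.
Qed.

(** Translating [x] by [- M1 d] turns the pattern into [x - M1 d, x, x + (M2 - M1) d]. With [u] in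
    the third slot, the maps are [M2 - M1] and [- M1], whose difference is [M2]. *)
Lemma trilin_uniform1 T M1 M2 u b c (e : R) :
    zmod_morphism M1 -> zmod_morphism M2 ->
    bijective M1 -> bijective M2 ->
    (forall t, `|b t| <= 1) -> (forall t, `|c t| <= 1) -> 0 <= e ->
    (#|G|%:R / #|T|%:R) ^+ 4 * \avg_z (autocorr u z ^+ 2) <= e ^+ 4 ->
  `|trilin T M1 M2 u b c| <= e.
Proof.
move=> M1add M2add bM1 bM2 b1 c1 e0 Se.
have -> : trilin T M1 M2 u b c = trilin T (M2 \- M1) (\- M1) b c u.
  apply: eq_mean => p _; rewrite -(mean_shift (- M1 (p.1 - p.2))).
  apply: eq_mean => x _ /=; rewrite subrK -addrA (addrC (- M1 _)).
  ring.
apply: trilin_uniform3 => //.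
- exact: zmod_morphism_sub.
- by move=> x y /=; rewrite M1add !opprB opprK addrC.
- by apply: bij_opp bM1 _.
- by apply: eq_bij bM2 _ _ => x /=; rewrite opprK subrK.
Qed.

(** Handles an L2-small factor [s] in any slot: [h] is the product of the three factors and [e1 p]
    the shift at which [s] is evaluated. *)
Lemma trilin_small T (e1 : G * G -> G) s (h : G * G -> G -> R) (e : R) :
    0 <= e -> \avg_x (s x ^+ 2) <= e ^+ 2 ->
    (forall p x, `|h p x| <= `|s (x + e1 p)|) ->
  `|\avg_(p in setX T T) (\avg_x (h p x))| <= e.
Proof.
move=> e0 se hs.
apply: le_trans (ler_norm_mean _ _) _; apply: mean_le_cst => // p _.
apply: le_trans (ler_norm_mean _ _) _; apply: le_trans (mean_abs_le e0 se).
rewrite -[leRHS](mean_shift (e1 p)); apply: le_mean => x _; exact: hs.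
Qed.

End Trilinear.

(** * Lower and upper bounds for the pattern average *)

Section Counting.
Variables (R : realFieldType) (G : finZmodType).
Implicit Types (f : G -> R) (A T : {set G}) (M : G -> G).

Definition ind A (x : G) : R := (x \in A)%:R.

Lemma ind_ge0_le1 A x : 0 <= ind A x <= 1.
Proof. by rewrite /ind; case: (x \in A); rewrite lexx ler01. Qed.

(** On nonnegative reals the cube lies above its tangent at the mean. *)
Lemma avg_pow3_ge f : (forall x, 0 <= f x) -> mean setT f ^+ 3 <= \avg_x (f x ^+ 3).
Proof.
move=> f0; set m := mean setT f; have m0 : 0 <= m by apply: mean_ge0.
have <- : \avg_x (3 * m ^+ 2 * f x - 2 * m ^+ 3) = m ^+ 3.
  by rewrite meanB meanZ avg_cst -/m; ring.
apply: le_mean => x _; rewrite -subr_ge0.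
have -> : f x ^+ 3 - (3 * m ^+ 2 * f x - 2 * m ^+ 3) = (f x - m) ^+ 2 * (f x + 2 * m).
  by ring.
by apply: mulr_ge0 (sqr_ge0 _) _; rewrite addr_ge0 // mulr_ge0.
Qed.

(** For each shift the two translated factors are replaced by [f] one at a time, at an L1 cost of at
    most [e] each. *)
Lemma trilin_periodic_ge T M1 M2 f (e : R) :
    (0 < #|T|)%N -> (forall x, 0 <= f x <= 1) -> 0 <= e ->
    periodic T M1 f e -> periodic T M2 f e ->
  mean setT f ^+ 3 - e *+ 2 <= trilin T M1 M2 f f f.
Proof.
move=> T0 f01 e0 p1 p2.
rewrite -[leLHS](mean_cst _ (card_setX_gt0 T0)).
apply: le_mean => -[t t'] /setXP[/= tT t'T].
have := avg_pow3_ge (fun x => proj1 (andP (f01 x))).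
have := shift_abs e0 (p1 _ _ tT t'T); have := shift_abs e0 (p2 _ _ tT t'T).
set d := t - t' => h2 h1 h3.
suff : \avg_x (f x ^+ 3) - \avg_x `|f (x + M1 d) - f x| - \avg_x `|f (x + M2 d) - f x|
    <= \avg_x (f x * f (x + M1 d) * f (x + M2 d)) by lra.
rewrite -!meanB; apply: le_mean => x _.
move: (f01 x) (f01 (x + M1 d)) (f01 (x + M2 d)).
set a := f x; set b := f (x + M1 d); set c := f (x + M2 d) => a01 b01 c01.
have wl (w y : R) : 0 <= w <= 1 -> - `|y| <= w * y.
  case/andP=> w0 w1; have := ler_norm (- (w * y)).
  rewrite normrN normrM (ger0_norm w0); have : w * `|y| <= `|y| by rewrite ler_piMl.
  by lra.
have m01 (v w : R) : 0 <= v <= 1 -> 0 <= w <= 1 -> 0 <= v * w <= 1.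
  by case/andP=> v0 v1 /andP[w0 w1]; rewrite mulr_ge0 //= mulr_ile1.
have := wl _ (b - a) (m01 _ _ a01 c01); have := wl _ (c - a) (m01 _ _ a01 a01).
have -> : a * b * c = a ^+ 3 + a * c * (b - a) + a * a * (c - a) by ring.
by lra.
Qed.

(** Writing [f = F + s + u] and replacing [f] by [F] slot by slot from the third leaves three terms
    with [u] and three with [s], each at most [e]; the all-[F] term loses [e *+ 2], hence
    [e *+ 8]. *)
Lemma trilin_ge T T' T'' M1 M2 f (e delta : R) :
    zmod_morphism M1 -> zmod_morphism M2 ->
    bijective M1 -> bijective M2 -> bijective (M1 \- M2) ->
    (forall x, 0 <= f x <= 1) -> 0 <= e ->
    (0 < #|T|)%N -> (0 < #|T'|)%N -> (0 < #|T''|)%N ->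
    periodic T' M1 (smooth T f) e -> periodic T' M2 (smooth T f) e ->
    periodic T'' id (autocorr f) delta ->
    (#|G|%:R / #|T'|%:R) ^+ 4 * (4 * delta ^+ 2) <= e ^+ 4 ->
    \avg_x ((smooth T'' f x - smooth T f x) ^+ 2) <= e ^+ 2 ->
  mean setT f ^+ 3 - e *+ 8 <= trilin T' M1 M2 f f f.
Proof.
move=> M1add M2add bM1 bM2 bM12 f01 e0 T0 T'0 T''0 per1 per2 per3 de es.
set F := smooth T f; set F'' := smooth T'' f.
pose s x := F'' x - F x; pose u x := f x - F'' x.
have n1 (g : G -> R) : (forall x, 0 <= g x <= 1) -> forall x, `|g x| <= 1.
  by move=> g01 x; case/andP: (g01 x) => g0 g1; rewrite ger0_norm.
have F01 : forall x, 0 <= F x <= 1 by exact: smooth_ge0_le1.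
have Su : (#|G|%:R / #|T'|%:R) ^+ 4 * \avg_z (autocorr u z ^+ 2) <= e ^+ 4.
  apply: le_trans de; rewrite ler_wpM2l //; last exact: autocorr_smooth.
  by rewrite exprn_ge0 // divr_ge0.
have [nf nF] := (n1 f f01, n1 F F01).
have u3 := trilin_uniform3 M1add M2add bM2 bM12 nf nf e0 Su.
have u2 := trilin_uniform2 M1add M2add bM1 bM12 nf nF e0 Su.
have u1 := trilin_uniform1 M1add M2add bM1 bM2 nF nF e0 Su.
have le1 (x y z : R) : `|x| <= 1 -> `|y| <= 1 -> `|x * y * z| <= `|z|.
  by move=> x1 y1; rewrite normrM ler_piMl // normrM mulr_ile1.
have s3 : `|trilin T' M1 M2 f f s| <= e.
  apply: (trilin_small T' (e1 := fun p => M2 (p.1 - p.2)) (s := s) (h := fun p x =>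
    f x * f (x + M1 (p.1 - p.2)) * s (x + M2 (p.1 - p.2))) e0 es) => p x.
  exact: le1.
have s2 : `|trilin T' M1 M2 f s F| <= e.
  apply: (trilin_small T' (e1 := fun p => M1 (p.1 - p.2)) (s := s) (h := fun p x =>
    f x * s (x + M1 (p.1 - p.2)) * F (x + M2 (p.1 - p.2))) e0 es) => p x.
  by rewrite mulrAC; exact: le1.
have s1 : `|trilin T' M1 M2 s F F| <= e.
  apply: (trilin_small T' (e1 := fun=> 0) (s := s) (h := fun p x =>
    s x * F (x + M1 (p.1 - p.2)) * F (x + M2 (p.1 - p.2))) e0 es) => p x.
  by rewrite addr0 -mulrA mulrC; exact: le1.
have FFF := trilin_periodic_ge T'0 F01 e0 per1 per2.
have split3 : trilin T' M1 M2 f f f =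
    trilin T' M1 M2 f f u + (trilin T' M1 M2 f f s +
   (trilin T' M1 M2 f u F + (trilin T' M1 M2 f s F +
   (trilin T' M1 M2 u F F + (trilin T' M1 M2 s F F + trilin T' M1 M2 F F F))))).
  rewrite /trilin -!meanD; apply: eq_mean => p _.
  by rewrite -!meanD; apply: eq_mean => x _; rewrite /u /s; ring.
move: u1 u2 u3 s1 s2 s3 FFF; rewrite split3 avg_smooth // !ler_norml.
by do 6 case/andP=> [? ?]; lra.
Qed.

(** For fixed [t] only [t' = t] gives the zero shift; it has weight [1 / #|T|] and value at most
    1. *)
Lemma trilin_ind_le T M1 M2 A (c : R) :
    zmod_morphism M1 -> zmod_morphism M2 ->
    (0 < #|T|)%N -> 0 <= c ->
    (forall d, d != 0 ->
      #|[set x | [&& x \in A, x + M1 d \in A & x + M2 d \in A]]|%:R <= c * #|G|%:R) ->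
  trilin T M1 M2 (ind A) (ind A) (ind A) <= c + #|T|%:R^-1.
Proof.
move=> M1add M2add T0 c0 hc; rewrite /trilin mean_setX.
have NR : 0 < #|G|%:R :> R by rewrite ltr0n card_zmod_gt0.
apply: mean_le_cst => [|t tT]; first by rewrite addr_ge0 ?invr_ge0.
have -> : #|T|%:R^-1 = \avg_(t' in T) (t' == t)%:R :> R.
  rewrite /mean (bigD1 t) //= eqxx big1 ?addr0 ?mul1r // => t' /andP[_ /negbTE ->].
  by [].
rewrite -[X in X + _](mean_cst _ T0) -meanD; apply: le_mean => t' _ /=.
have [->|ne] := eqVneq t' t.
  apply: le_trans (_ : 1 <= _); last by rewrite lerDr.
  apply: mean_le_cst => // x _; rewrite /ind -!natrM lern1.
  by case: (x \in A); case: (_ \in A); case: (_ \in A).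
have /hc : t - t' != 0 by rewrite subr_eq0 eq_sym.
rewrite addr0 -ler_pdivrMr //; apply: le_trans.
rewrite /mean cardsT ler_wpM2r ?invr_ge0 // -sum1_card natr_sum.
rewrite big_mkcond [leRHS]big_mkcond; apply: ler_sum => x _.
by rewrite !inE /ind -!natrM !mulnb andbA; case: (_ && _).
Qed.

(** The first clause controls [f - smooth T' f], the second the energy increment, the last two the
    main term. *)
Definition refines A M1 M2 T T' (delta : R) :=
  [/\ periodic T' id (autocorr (ind A)) delta,
      periodic T' id (smooth T (ind A)) delta,
      periodic T' M1 (smooth T (ind A)) delta &
      periodic T' M2 (smooth T (ind A)) delta].

End Counting.
Arguments ind {R G}.

(** * Chains of refinements *)

Lemma refinement (R : archiRealFieldType) (tau delta : R) :
    0 < tau <= 1 -> 0 < delta ->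
  exists2 tau' : R, 0 < tau' <= 1 &
    forall (G : finZmodType) (M1 M2 : G -> G) (A T : {set G}),
      zmod_morphism M1 -> zmod_morphism M2 -> tau * #|G|%:R <= #|T|%:R ->
      exists2 T' : {set G}, tau' * #|G|%:R <= #|T'|%:R & refines A M1 M2 T T' delta.
Proof.
case/andP=> tau0 tau1 d0.
(* Here 32 is [8 * n] with [n = 4]. For [k > x] the error is at most [(tau * delta)^2], and passing
   to [smooth T] loses at most [tau^-2]. *)
pose x := 32 / (tau ^+ 2 * delta ^+ 2).
have x0 : 0 <= x by rewrite divr_ge0 // mulr_ge0 ?sqr_ge0.
pose k := (Num.bound x).+1.
have xk : x < k%:R.
  by apply: lt_le_trans (archi_boundP x0) _; rewrite ler_nat.
pose c := (2 * 2 ^ (4 * k))%N.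
have c0 : (0 < c)%N by rewrite muln_gt0 expn_gt0.
exists c%:R^-1; first by rewrite invr_gt0 ltr0n c0 invf_le1 ?ltr0n ?ler1n.
move=> G M1 M2 A T M1add M2add Ttau.
have NR : 0 < #|G|%:R :> R by rewrite ltr0n card_zmod_gt0.
have TR : 0 < #|T|%:R :> R by apply: lt_le_trans Ttau; rewrite mulr_gt0.
(* Index 0 yields the autocorrelation of [A]; indices 1, 2, 3 yield [smooth T] under [id], [M1],
   [M2]. *)
pose S (j : 'I_4) := if j == 0 then A else T.
pose L (j : 'I_4) := nth id [:: id; id; M1; M2] j.
have Ladd j : zmod_morphism (L j) by case: j => [[|[|[|[|?]]]] ?].
have [T' [cT' perT']] :=
  almost_periods S (L := L) (isT : 0 < 4)%N (ltn0Sn _ : 0 < k)%N Ladd (@ind_ge0_le1 R G A).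
exists T'.
  by rewrite mulrC ler_pdivrMr ?ltr0n // -natrM ler_nat mulnC.
have per j t t' : t \in T' -> t' \in T' ->
    shift_dist (corr (S j) (ind A)) (L j (t - t')) <= tau ^+ 2 * delta ^+ 2.
  move=> tT t'T; have := perT' j _ _ tT t'T.
  rewrite -ler_pdivlMl ?ltr0n //; move/le_trans; apply.
  rewrite ler_pdivrMl ?ltr0n // -ler_pdivrMr ?mulr_gt0 ?exprn_gt0 //.
  exact: ltW.
have persm (j : 'I_4) t t' : j != 0 -> t \in T' -> t' \in T' ->
    shift_dist (smooth T (ind A)) (L j (t - t')) <= delta ^+ 2.
  move=> j0 tT t'T; have := per j _ _ tT t'T; rewrite /S (negbTE j0) => h.
  apply: le_trans (shift_dist_smooth _ _ _) _.
  apply: le_trans (ler_wpM2l (sqr_ge0 _) h) _.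
  rewrite mulrA -exprMn ler_piMl ?sqr_ge0 // expr_le1 //.
    by rewrite mulrAC ler_pdivrMr // mul1r mulrC.
  by rewrite mulr_ge0 ?divr_ge0 // ltW.
split=> t t' tT t'T.
- apply: le_trans (per ord0 _ _ tT t'T) _.
  by rewrite ler_piMl ?sqr_ge0 // expr_le1 // ltW.
- exact: (persm (Ordinal (isT : 1 < 4)%N)).
- exact: (persm (Ordinal (isT : 2 < 4)%N)).
- exact: (persm (Ordinal (isT : 3 < 4)%N)).
Qed.

(** The tolerance [delta] may vary along the chain, as the third clause ties it to the density of
    [T]. *)
Definition step (R : realFieldType) (G : finZmodType) (A : {set G}) (M1 M2 : G -> G)
    (e : R) (T T' : {set G}) :=
  exists delta : R, [/\ 0 <= delta, delta <= e ^+ 2 / 16,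
    (#|G|%:R / #|T|%:R) ^+ 4 * (4 * delta ^+ 2) <= e ^+ 4 &
    refines A M1 M2 T T' delta].

Lemma iterated_refinement (R : archiRealFieldType) (e : R) (n : nat) : 0 < e ->
  exists2 tau : R, 0 < tau <= 1 &
    forall (G : finZmodType) (M1 M2 : G -> G) (A : {set G}),
      zmod_morphism M1 -> zmod_morphism M2 ->
      exists2 T : nat -> {set G},
        forall i, (i <= n)%N -> tau * #|G|%:R <= #|T i|%:R &
        forall i, (i < n)%N -> step A M1 M2 e (T i) (T i.+1).
Proof.
move=> e0; elim: n => [|n [tau /andP[tau0 tau1] IH]].
  exists 1; first by rewrite ltr01 lexx.
  by move=> G M1 M2 A _ _; exists (fun=> setT) => // i _; rewrite cardsT mul1r.
(* Since [tau <= 1] this is at most [e^2 / 16]; the factor [tau^2] offsets the fourth power of the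
   inverse density. *)
pose delta := e ^+ 2 * tau ^+ 2 / 16.
have d0 : 0 < delta by rewrite divr_gt0 ?mulr_gt0 ?exprn_gt0.
have tau01 : 0 < tau <= 1 by rewrite tau0.
have [tau' /andP[tau'0 tau'1] ref] := refinement tau01 d0.
exists (Num.min tau tau'); first by rewrite lt_min tau0 tau'0 ge_min tau1.
move=> G M1 M2 A M1add M2add.
have NR : 0 < #|G|%:R :> R by rewrite ltr0n card_zmod_gt0.
have [T cT sT] := IH G M1 M2 A M1add M2add.
have [T' cT' refT'] := ref G M1 M2 A (T n) M1add M2add (cT n (leqnn n)).
exists (fun i => if (i <= n)%N then T i else T') => i.
  move=> _; case: leqP => [/cT|_].
    by apply: le_trans; rewrite ler_pM2r // ge_min lexx.
  by apply: le_trans cT'; rewrite ler_pM2r // ge_min lexx orbT.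
move=> lin; have [->|{}lin] : i = n \/ (i < n)%N by lia.
  rewrite leqnn ltnn; exists delta; split=> //; first exact: ltW.
    by rewrite ler_pM2r ?invr_gt0 // ler_piMr ?sqr_ge0 // expr_le1 // ltW.
  have TR : 0 < #|T n|%:R :> R by apply: lt_le_trans (cT n (leqnn n)); rewrite mulr_gt0.
  set r := _ / _.
  have r0 : 0 <= r by rewrite divr_ge0.
  have rt : r * tau <= 1 by rewrite mulrAC ler_pdivrMr // mul1r mulrC cT.
  have -> : r ^+ 4 * (4 * delta ^+ 2) = (r * tau) ^+ 4 / 64 * e ^+ 4.
    by rewrite /delta; field.
  have e4_ge0 : 0 <= e ^+ 4 by rewrite exprn_ge0 // ltW.
  rewrite ler_piMl // ler_pdivrMr // mul1r.
  apply: le_trans (_ : 1 <= _); last by rewrite ler1n.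
  by rewrite expr_le1 // mulr_ge0 // ltW.
by rewrite lin (ltnW lin); exact: sT.
Qed.

(** * Energy pigeonhole, choice of parameters and conclusion *)

(** Otherwise [a m] would be at least [m * eta], which exceeds 1. *)
Lemma small_increment (R : realFieldType) (a : nat -> R) (eta : R) (m : nat) :
  (forall i, 0 <= a i <= 1) -> 1 < m%:R * eta ->
  exists2 j, (j < m)%N & a j.+1 - a j <= eta.
Proof.
move=> a01 meta.
have [/existsP[j aj]|] := boolP [exists j : 'I_m, a j.+1 - a j <= eta].
  by exists j.
rewrite negb_exists => /forallP h.
have grow j : (j <= m)%N -> j%:R * eta <= a j.
  elim: j => [_|j IH lt_jm]; first by rewrite mul0r; case/andP: (a01 0%N).
  have := h (Ordinal lt_jm); rewrite -ltNge /=; have := IH (ltnW lt_jm).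
  by rewrite -[j.+1]addn1 natrD mulrDl mul1r; lra.
by have := grow m (leqnn m); case/andP: (a01 m) => _; lra.
Qed.

Theorem theorem7p3 (R : realType) (alpha eps : R)
    (alpha_gt0 : 0 < alpha) (eps_gt0 : 0 < eps) :
  exists N0 : nat,
    forall (G : finZmodType) (M1 M2 : G -> G) (A : {set G}),
      (N0 <= #|G|)%N ->
      is_automorphism M1 ->
      is_automorphism M2 ->
      is_automorphism (M1 \- M2) ->
      alpha * #|G|%:R <= #|A|%:R ->
      exists d : G, d != 0 /\
        (alpha ^+ 3 - eps) * #|G|%:R <=
          #|[set x : G | [&& x \in A, x + M1 d \in A & x + M2 d \in A]]|%:R.
Proof.
(* The loss [e *+ 8] is at most [eps / 2]; with [eps / 3] for the zero shift it stays below
   [eps]. *)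
pose e := Num.min eps 1 / 16.
have e0 : 0 < e by rewrite divr_gt0 // lt_min eps_gt0 ltr01.
have [ee e1] : e <= eps / 16 /\ e <= 1 / 16.
  by rewrite /e !ler_pM2r ?invr_gt0 // !ge_min !lexx orbT.
(* Energy is examined at every second set of a chain of length [2 * m], so some pair of consecutive
   steps raises it by at most [e^2 / 4]. *)
pose m := Num.bound (4 / e ^+ 2).
have mP : 1 < m%:R * (e ^+ 2 / 4).
  rewrite -ltr_pdivrMr ?divr_gt0 ?exprn_gt0 // mul1r invf_div.
  by apply: archi_boundP; rewrite divr_ge0 ?sqr_ge0.
have [tau /andP[tau0 tau1] chain] := iterated_refinement (2 * m) e0.
(* The bound makes [1 / #|T|] at most [eps / 3] along the chain; the [.+2] ensures that [G] has a
   nonzero element. *)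
exists (Num.bound (3 / (eps * tau))).+2 => G M1 M2 A GN [M1add bM1] [M2add bM2] [_ bM12] cA.
have NR : 0 < #|G|%:R :> R by rewrite ltr0n card_zmod_gt0.
have [T cT sT] := chain G M1 M2 A M1add M2add.
have cardT i : (i <= 2 * m)%N -> (0 < #|T i|)%N.
  by move=> /cT h; rewrite -(ltr0n R); apply: lt_le_trans h; rewrite mulr_gt0.
have f01 := @ind_ge0_le1 R G A.
pose f := @ind R G A.
pose en i := \avg_x (smooth (T i) f x ^+ 2).
have en01 i : 0 <= en i <= 1.
  have F01 := smooth_ge0_le1 (T i) f01.
  apply/andP; split; first by apply: mean_ge0 => x _; exact: sqr_ge0.
  by apply: mean_le_cst => // x _; case/andP: (F01 x) => F0 F1; rewrite expr_le1.
have [j jm incr] := small_increment (fun j => en01 (2 * j)%N) mP.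
have [T1 T2 T3] : [/\ (2 * j <= 2 * m)%N, ((2 * j).+1 <= 2 * m)%N & ((2 * j).+2 <= 2 * m)%N].
  by clear -jm; split; lia.
have [d1 [d1_ge0 d1e _ [_ p1 p1M1 p1M2]]] := sT _ T2.
have [d2 [d2_ge0 d2e d2U [p2K p2 _ _]]] := sT _ T3.
have inc1 := energy_increment f01 d1_ge0 (cardT _ T1) (cardT _ T2) p1.
have inc2 := energy_increment f01 d2_ge0 (cardT _ T2) (cardT _ T3) p2.
have e2e : e ^+ 2 <= e by rewrite expr2 ler_piMl //; lra.
have d1e2 : d1 ^+ 2 <= e ^+ 2 by rewrite ler_sqr ?nnegrE //; lra.
have close : \avg_x ((smooth (T (2 * j).+2) f x - smooth (T (2 * j)%N) f x) ^+ 2) <= e ^+ 2.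
  pose F i := smooth (T i) f.
  (* The total is twice the energy gain plus [4 * (d1 + d2)], at most [e^2 / 2 + e^2 / 2]. *)
  apply: le_trans (_ : \avg_x (2 * (F (2 * j).+2 x - F (2 * j).+1 x) ^+ 2 +
      2 * (F (2 * j).+1 x - F (2 * j)%N x) ^+ 2) <= _).
    apply: le_mean => x _; rewrite -[smooth (T (2 * j).+2) f x]/(F _ x) -[smooth (T (2 * j)%N) f x]/(F _ x).
    set a := F (2 * j).+2 x; set b := F (2 * j).+1 x; set c := F (2 * j)%N x.
    rewrite -subr_ge0; have -> : 2 * (a - b) ^+ 2 + 2 * (b - c) ^+ 2 - (a - c) ^+ 2 =
      (a - 2 * b + c) ^+ 2 by ring.
    exact: sqr_ge0.
  rewrite meanD !meanZ; move: incr inc1 inc2; rewrite mulnS -/(en _) -/(en _).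
  rewrite /en /F -/f; lra.
have count := trilin_ge M1add M2add bM1 bM2 bM12 f01 (ltW e0) (cardT _ T1)
  (cardT _ T2) (cardT _ T3) (fun t t' h h' => le_trans (p1M1 t t' h h') d1e2)
  (fun t t' h h' => le_trans (p1M2 t t' h h') d1e2) p2K d2U close.
have [/existsP[d /andP[d0 dP]]|] := boolP [exists d : G, (d != 0) &&
    ((alpha ^+ 3 - eps) * #|G|%:R <=
     #|[set x : G | [&& x \in A, x + M1 d \in A & x + M2 d \in A]]|%:R)].
  by exists d.
rewrite negb_exists => /forallP few.
have {}few d : d != 0 ->
    #|[set x | [&& x \in A, x + M1 d \in A & x + M2 d \in A]]|%:R <
    (alpha ^+ 3 - eps) * #|G|%:R.
  by move=> d0; have := few d; rewrite d0 /= -ltNge.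
(* A nonzero shift exists, and its nonnegative count forces the threshold [alpha ^+ 3 - eps] to be
   positive. *)
have [x [y [_ _ xy]]] : exists x y, [/\ x \in G, y \in G & x != y].
  by apply/card_gt1P; exact: leq_trans GN.
have c0 : 0 < alpha ^+ 3 - eps.
  rewrite -(pmulr_lgt0 _ NR); apply: le_lt_trans (few (x - y) _) => //.
  by rewrite subr_eq0.
have := trilin_ind_le M1add M2add (cardT _ T2) (ltW c0) (fun d d0 => ltW (few d d0)).
have inv_small : #|T (2 * j).+1|%:R^-1 <= eps / 3 :> R.
  have -> : eps / 3 = (3 / eps)^-1 by rewrite invf_div.
  rewrite lef_pV2 ?posrE ?divr_gt0 ?ltr0n ?cardT //.
  apply: le_trans (cT _ T2); rewrite -ler_pdivrMl // mulrC -mulrA -invfM.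
  have xb : 0 <= 3 / (eps * tau) by rewrite divr_ge0 // mulr_ge0 // ltW.
  apply: le_trans (ltW (archi_boundP xb)) _; rewrite ler_nat.
  by apply: leq_trans GN; exact: leqW.
have fA : alpha ^+ 3 <= mean setT f ^+ 3.
  apply: lerXn2r; rewrite ?nnegrE; first exact: ltW.
    by apply: mean_ge0 => z _; case/andP: (f01 z).
  rewrite /mean cardsT ler_pdivlMr //; apply: le_trans cA _.
  rewrite -sum1_card natr_sum big_mkcond [leRHS]big_mkcond; apply: ler_sum => z _.
  by rewrite inE /f /ind; case: (z \in A).
by move: count; rewrite -/f; lra.
Qed.
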